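(* For integers $m\ge 0$ and $r\ge 1$, let $a_{mr}$ denote the number of stable rooted ribbon trees $T$ with $r$ leaves and $d(T)=m$, and let $$f(t,x)\coloneqq\sum_{m\ge 0,\ r\ge 1} a_{mr}\,t^m x^r\in\mathbb{Q}[[t,x]].$$ Then $f$ satisfies $$f=\frac{f^2}{1-tf}+x,\qquad \frac{\partial f}{\partial x}(0,0)=1,$$ and $f$ is the unique formal power series in $\mathbb{Q}[[t,x]]$ satisfying these two equations.
   Context: A rooted ribbon tree (RRT) is a finite rooted tree together with a planar structure, i.e. a linear ordering of the children of each vertex; trees are considered up to isomorphism preserving the root and these orderings. A leaf is a vertex with no children (when the tree consists of a single vertex, that vertex is its unique leaf), and an internal vertex is a vertex which is not a leaf. An RRT is stable if every internal vertex has at least $2$ children. For a stable RRT $T$ with $r$ leaves and set of internal vertices $T_{\mathrm{int}}$, its dimension is $d(T)\coloneqq r-\#T_{\mathrm{int}}-1$. (The stable RRTs with $r$ leaves are the faces of the associahedron $K_r$, and $d(T)$ is the dimension of the corresponding face; e.g. for $r=4$ there are $5$ trees of dimension $0$, $5$ of dimension $1$ and $1$ of dimension $2$.) Note that in $\mathbb{Q}[[t,x]]$ the element $1-tg$ is invertible for every $g$, so the equation makes sense for every formal power series. *)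

(* Defs.v *)
From HB Require Import structures.
From mathcomp Require Import all_boot all_order all_algebra.
From mathcomp Require Import finmap.
From mathcomp Require Import boolp classical_sets cardinality.

Set Implicit Arguments.
Unset Strict Implicit.
Unset Printing Implicit Defensive.

Import GRing.Theory.
Local Open Scope ring_scope.

(** * Rooted ribbon trees *)

(* The list records the children of the root in their linear order, so two
   rooted ribbon trees are isomorphic exactly when they are equal terms. *)
Inductive rrt : Type := Node of seq rrt.

Definition children (T : rrt) : seq rrt := let: Node s := T in s.

(* A vertex is represented by the subtree of its descendants; each vertex
   contributes one entry, so equal subtrees are listed with multiplicity. *)
Fixpoint vertices (T : rrt) : seq rrt :=
  let: Node s := T in T :: flatten (map vertices s).

Definition is_leaf (v : rrt) : bool := nilp (children v).
Definition is_internal (v : rrt) : bool := ~~ is_leaf v.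

Definition nleaves (T : rrt) : nat := count is_leaf (vertices T).
Definition ninternal (T : rrt) : nat := count is_internal (vertices T).

Definition is_stable (T : rrt) : bool :=
  all (fun v => is_internal v ==> (2 <= size (children v))%N) (vertices T).

Definition rrt_dim (T : rrt) : int := (nleaves T)%:Z - (ninternal T)%:Z - 1.

HB.instance Definition _ := gen_eqMixin rrt.
HB.instance Definition _ := gen_choiceMixin rrt.

Definition stable_rrts (m r : nat) : set rrt :=
  [set T | [/\ is_stable T, nleaves T = r & rrt_dim T = m%:Z]]%classic.

(* [fset_set] sends infinite sets to the empty one; see
   [finite_stable_rrts] below. *)
Definition num_stable_rrts (m r : nat) : nat :=
  #|` fset_set (stable_rrts m r) |%fset.

Section Finiteness.
Local Open Scope nat_scope.

Fixpoint bounded_seqs (s : seq rrt) (n : nat) : seq (seq rrt) :=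
  if n is n'.+1 then
    [::] :: [seq x :: l | x <- s, l <- bounded_seqs s n']
  else [:: [::]].

Lemma mem_bounded_seqs s n l :
  size l <= n -> {subset l <= s} -> l \in bounded_seqs s n.
Proof.
elim: n l => [|n IH] [|x l] //= ln ls; rewrite inE /=.
apply/allpairsP; exists (x, l); split => //=; first exact/ls/mem_head.
by apply: IH => // y yl; apply: ls; rewrite inE yl orbT.
Qed.

Lemma size_vertices_gt0 T : 0 < size (vertices T).
Proof. by case: T. Qed.

Lemma size_children s : size s <= size (flatten (map vertices s)).
Proof.
elim: s => //= x s IH; rewrite size_cat -add1n.
exact: leq_add (size_vertices_gt0 x) IH.
Qed.

Lemma size_child s x :
  x \in s -> size (vertices x) <= size (flatten (map vertices s)).
Proof.
elim: s => //= y s IH; rewrite inE size_cat => /orP[/eqP->|/IH h].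
  exact: leq_addr.
exact: leq_trans h (leq_addl _ _).
Qed.

Lemma finite_rrt_size n :
  exists s : seq rrt, forall T, size (vertices T) <= n -> T \in s.
Proof.
elim: n => [|n [s IH]]; first by exists [::]; case.
exists (map Node (bounded_seqs s n)) => -[l] /=; rewrite ltnS => ln.
apply: map_f; apply: mem_bounded_seqs.
  exact: leq_trans (size_children l) ln.
by move=> x xl; apply: IH; exact: leq_trans (size_child xl) ln.
Qed.

Lemma stable_size n T :
  size (vertices T) <= n -> is_stable T -> ninternal T < nleaves T.
Proof.
elim: n T => [|n IH] [s]; rewrite ?ltn0 //= ltnS => sn.
rewrite /is_stable /ninternal /nleaves /= {1 2 3}/is_internal /is_leaf /=.
case: (posnP (size s)) => [/size0nil -> //|s0].
have -> : nilp s = false by rewrite /nilp; case: (size s) s0.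
rewrite add1n add0n /= => /andP[s2 st].
suff : count is_internal (flatten (map vertices s)) + size s <=
       count is_leaf (flatten (map vertices s)).
  by apply: leq_trans; rewrite -addn2 leq_add2l.
have {s0 s2} : forall x, x \in s -> size (vertices x) <= n.
  by move=> x xs; exact: leq_trans (size_child xs) sn.
elim: s st {sn} => //= x s IHs; rewrite all_cat => /andP[sx ss] sn.
rewrite !count_cat -add1n addnACA; apply: leq_add.
  by rewrite addn1; apply: IH => //; apply/sn/mem_head.
by apply: IHs => // y ys; apply: sn; rewrite inE ys orbT.
Qed.

Lemma finite_stable_rrts m r : finite_set (stable_rrts m r).
Proof.
have [s sP] := finite_rrt_size (r + r).
apply: (sub_finite_set _ (finite_seq s)) => T [st Tr _] /=; apply: sP.
rewrite -(count_predC is_leaf) -/(nleaves T) Tr leq_add2l -Tr.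
exact/ltnW/(stable_size (leqnn _)).
Qed.

End Finiteness.

(** * The ring Q[[t, x]] *)

(* [coef2 f m r] is the coefficient of t^m x^r. *)
Record fps2 : Type := Fps2 { coef2 : nat -> nat -> rat }.

Lemma fps2P f g : (forall m r, coef2 f m r = coef2 g m r) -> f = g.
Proof.
case: f g => [f] [g] /= fg; congr Fps2.
by apply/funext => m; apply/funext => r; exact: fg.
Qed.

HB.instance Definition _ := gen_eqMixin fps2.
HB.instance Definition _ := gen_choiceMixin fps2.

Definition fps2_zero := Fps2 (fun _ _ => 0).
Definition fps2_opp f := Fps2 (fun m r => - coef2 f m r).
Definition fps2_add f g := Fps2 (fun m r => coef2 f m r + coef2 g m r).
Definition fps2_one := Fps2 (fun m r => ((m == 0%N) && (r == 0%N))%:R).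
Definition fps2_mul f g := Fps2 (fun m r =>
  \sum_(i < m.+1) \sum_(j < r.+1) coef2 f i j * coef2 g (m - i) (r - j)).

Fact fps2_addA : associative fps2_add.
Proof. by move=> f g h; apply: fps2P => m r /=; rewrite addrA. Qed.
Fact fps2_addC : commutative fps2_add.
Proof. by move=> f g; apply: fps2P => m r /=; rewrite addrC. Qed.
Fact fps2_add0 : left_id fps2_zero fps2_add.
Proof. by move=> f; apply: fps2P => m r /=; rewrite add0r. Qed.
Fact fps2_addN : left_inverse fps2_zero fps2_opp fps2_add.
Proof. by move=> f; apply: fps2P => m r /=; rewrite addNr. Qed.

HB.instance Definition _ :=
  GRing.isZmodule.Build fps2 fps2_addA fps2_addC fps2_add0 fps2_addN.

(* The multiplicative axioms are transported from {poly {poly rat}}, with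
   which products agree below any truncation order [n]. *)
Definition fps2_trunc n f : {poly {poly rat}} :=
  \poly_(i < n) \poly_(j < n) coef2 f i j.

Lemma fps2_trunc_coef n f m r :
  (m < n)%N -> (r < n)%N -> (fps2_trunc n f)`_m`_r = coef2 f m r.
Proof. by move=> mn rn; rewrite coef_poly mn coef_poly rn. Qed.

Lemma coef2_mul_poly n f g (p q : {poly {poly rat}}) m r :
  (m < n)%N -> (r < n)%N ->
  (forall i j, (i < n)%N -> (j < n)%N -> p`_i`_j = coef2 f i j) ->
  (forall i j, (i < n)%N -> (j < n)%N -> q`_i`_j = coef2 g i j) ->
  (p * q)`_m`_r = coef2 (fps2_mul f g) m r.
Proof.
move=> mn rn pf qg; rewrite coefM coef_sum /=; apply: eq_bigr => i _.
rewrite coefM; apply: eq_bigr => j _.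
have im : (i < n)%N by apply: leq_ltn_trans mn; rewrite -ltnS.
have jr : (j < n)%N by apply: leq_ltn_trans rn; rewrite -ltnS.
by rewrite pf // qg //; apply: leq_ltn_trans (leq_subr _ _) _.
Qed.

Lemma fps2_trunc_mul n f g m r : (m < n)%N -> (r < n)%N ->
  (fps2_trunc n f * fps2_trunc n g)`_m`_r = coef2 (fps2_mul f g) m r.
Proof.
by move=> mn rn; apply: (coef2_mul_poly mn rn) => i j i_n j_n;
  exact: fps2_trunc_coef.
Qed.

Fact fps2_mulA : associative fps2_mul.
Proof.
move=> f g h; apply: fps2P => m r; set n := (maxn m r).+1.
have mn : (m < n)%N by rewrite ltnS leq_maxl.
have rn : (r < n)%N by rewrite ltnS leq_maxr.
pose c := @fps2_trunc_coef n; pose cM := @fps2_trunc_mul n.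
rewrite -(@coef2_mul_poly n f (fps2_mul g h) (fps2_trunc n f)
           (fps2_trunc n g * fps2_trunc n h)) //; [|exact: c|exact: cM].
by rewrite mulrA; apply: coef2_mul_poly mn rn _ _; [exact: cM|exact: c].
Qed.

Fact fps2_mulC : commutative fps2_mul.
Proof.
move=> f g; apply: fps2P => m r; set n := (maxn m r).+1.
have mn : (m < n)%N by rewrite ltnS leq_maxl.
have rn : (r < n)%N by rewrite ltnS leq_maxr.
by rewrite -!(@fps2_trunc_mul n) // mulrC.
Qed.

Fact fps2_mul1 : left_id fps2_one fps2_mul.
Proof.
move=> f; apply: fps2P => m r /=.
rewrite big_ord_recl big_ord_recl /= mul1r !subn0.
by rewrite !big1 ?addr0 // => i _; rewrite ?big1 // => *; rewrite mul0r.
Qed.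

Fact fps2_mulDl : left_distributive fps2_mul fps2_add.
Proof.
move=> f g h; apply: fps2P => m r /=; rewrite -big_split.
apply: eq_bigr => i _; rewrite -big_split.
by apply: eq_bigr => j _; rewrite mulrDl.
Qed.

Fact fps2_one_neq0 : fps2_one != 0.
Proof.
by apply/eqP => /(congr1 (fun f => coef2 f 0 0)) /= /eqP; rewrite oner_eq0.
Qed.

HB.instance Definition _ := GRing.Zmodule_isComNzRing.Build fps2
  fps2_mulA fps2_mulC fps2_mul1 fps2_mulDl fps2_one_neq0.

Definition fps2_unit : {pred fps2} := fun f => `[< exists g, g * f = 1 >].
Definition fps2_inv (f : fps2) : fps2 :=
  if pselect (exists g, g * f = 1) is left h then projT1 (cid h) else f.

Fact fps2_mulV : {in fps2_unit, left_inverse 1 fps2_inv *%R}.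
Proof.
move=> f /asboolP fu; rewrite /fps2_inv; case: pselect => // h.
exact: projT2 (cid h).
Qed.
Fact fps2_unitP (f g : fps2) : g * f = 1 -> fps2_unit f.
Proof. by move=> gf; apply/asboolP; exists g. Qed.
Fact fps2_inv_out : {in [predC fps2_unit], fps2_inv =1 id}.
Proof.
move=> f /negP fu; rewrite /fps2_inv; case: pselect => // h.
by case: fu; apply/asboolP.
Qed.

HB.instance Definition _ := GRing.ComNzRing_hasMulInverse.Build fps2
  fps2_mulV fps2_unitP fps2_inv_out.

Definition fps2_t : fps2 := Fps2 (fun m r => ((m == 1%N) && (r == 0%N))%:R).
Definition fps2_x : fps2 := Fps2 (fun m r => ((m == 0%N) && (r == 1%N))%:R).

Definition fps2_dx (f : fps2) : fps2 :=
  Fps2 (fun m r => coef2 f m r.+1 *+ r.+1).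

Definition fps2_at00 (f : fps2) : rat := coef2 f 0 0.

Lemma coef2M (f g : fps2) m r : coef2 (f * g) m r =
  \sum_(i < m.+1) \sum_(j < r.+1) coef2 f i j * coef2 g (m - i) (r - j).
Proof. by []. Qed.

Lemma coef2D (f g : fps2) m r : coef2 (f + g) m r = coef2 f m r + coef2 g m r.
Proof. by []. Qed.

Lemma coef2N (f : fps2) m r : coef2 (- f) m r = - coef2 f m r.
Proof. by []. Qed.

Lemma coef2_tM (f : fps2) m r :
  coef2 (fps2_t * f) m r = if m is m'.+1 then coef2 f m' r else 0.
Proof.
rewrite coef2M big_ord_recl big1 ?add0r => [|j _]; last by rewrite mul0r.
case: m => [|m]; first by rewrite big_ord0.
rewrite big_ord_recl big_ord_recl /= mul1r subn0 subSS subn0.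
by rewrite !big1 ?addr0 // => i _; rewrite ?big1 // => *; rewrite mul0r.
Qed.

Lemma coef2_tMexp (g : fps2) n m r :
  (m < n)%N -> coef2 ((fps2_t * g) ^+ n) m r = 0.
Proof.
elim: n m r => // n IH m r; rewrite ltnS exprS -mulrA coef2_tM.
case: m => // m mn; rewrite coef2M big1 // => i _; rewrite big1 // => j _.
by rewrite IH ?mulr0 //; apply: leq_ltn_trans (leq_subr _ _) mn.
Qed.

Lemma unit_1_sub_tM (g : fps2) : 1 - fps2_t * g \is a GRing.unit.
Proof.
pose s n := \sum_(k < n) (fps2_t * g) ^+ k.
pose y := Fps2 (fun m r => coef2 (s m.+1) m r).
have sE n m r : (m < n)%N -> coef2 (s n) m r = coef2 y m r.
  elim: n => // n IH; rewrite ltnS leq_eqVlt => /orP[/eqP-> //|mn].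
  by rewrite /s big_ord_recr coef2D coef2_tMexp // addr0 IH.
apply/unitrPr; exists y; apply: fps2P => m r.
have -> : coef2 ((1 - fps2_t * g) * y) m r =
          coef2 ((1 - fps2_t * g) * s m.+1) m r.
  rewrite !coef2M; apply: eq_bigr => i _; apply: eq_bigr => j _.
  by rewrite -(sE m.+1) // ltnS leq_subr.
have -> : (1 - fps2_t * g) * s m.+1 = 1 - (fps2_t * g) ^+ m.+1.
  by rewrite -[LHS]opprK -mulNr opprB -subrX1 opprB.
rewrite coef2D coef2N coef2_tMexp //.
by rewrite oppr0 addr0.
Qed.

(** * The generating function *)

Definition rrt_gf : fps2 :=
  Fps2 (fun m r => if (1 <= r)%N then (num_stable_rrts m r)%:R else 0).

(* Main.v *)
(* Removing the first child of the root of a tree with at least two children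
   leaves either one child, hence a pair of trees, or a tree that is again
   stable and not a leaf.  In terms of the series g of the stable trees which
   are not leaves this reads g = f^2 + t f g, and f = g + x.
   Clearing denominators, the equation becomes f = x + (1 + t) f^2 - t x f;
   for a solution, the condition on the derivative forces f(0,0) = 0, so the
   difference h of two solutions satisfies h u = 0 with u(0,0) = 1. *)

Require Import Defs.
From mathcomp Require Import all_boot all_order all_algebra.
From mathcomp Require Import finmap zify ring.
From mathcomp Require Import classical_sets cardinality.

Set Implicit Arguments.
Unset Strict Implicit.
Unset Printing Implicit Defensive.

Import GRing.Theory.
Local Open Scope ring_scope.

(** * Generating functions of weighted sets *)

Definition fiber {T : Type} (D : set T) (w : T -> nat * nat) (m r : nat) :
  set T := [set x | D x /\ w x = (m, r)]%classic.

(** The bivariate generating series of [D], graded by [w]. Since [fset_set] sends an infinite set to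
    the empty one, the coefficients are true counts only under [finite_fibers]. *)
Definition gf {T : choiceType} (D : set T) (w : T -> nat * nat) : fps2 :=
  Fps2 (fun m r => (#|` fset_set (fiber D w m r)|%fset)%:R).

Definition finite_fibers {T : Type} (D : set T) (w : T -> nat * nat) : Prop :=
  forall m r, finite_set (fiber D w m r).

Definition addw {T U : Type} (w : T -> nat * nat) (v : U -> nat * nat)
    (p : T * U) : nat * nat :=
  ((w p.1).1 + (v p.2).1, (w p.1).2 + (v p.2).2)%N.

Lemma finite_fibers_sub {T : Type} (D E : set T) w :
  (D `<=` E)%classic -> finite_fibers E w -> finite_fibers D w.
Proof.
by move=> DE fE m r; apply: sub_finite_set (fE m r) => x [/DE Ex wx]; split.
Qed.

(** Transfer along a weight-preserving bijection from [D] to [E]: each fiber of [E] is the injective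
    image of the fiber of [D], hence finite as well. *)
Lemma gf_image {T U : choiceType} (h : T -> U) (D : set T) (E : set U) w v :
  finite_fibers D w ->
  (forall x, D x -> E (h x) /\ v (h x) = w x) ->
  (forall x y, D x -> D y -> h x = h y -> x = y) ->
  (forall y, E y -> exists2 x, D x & h x = y) ->
  gf E v = gf D w.
Proof.
move=> fD hE hinj hsurj; apply: fps2P => m r /=; congr (_%:R).
have -> : fiber E v m r = (h @` fiber D w m r)%classic.
  apply/seteqP; split => [y [/hsurj[x Dx <-] vy]|_ [x [Dx wx] <-]].
    by exists x => //; split => //; rewrite -vy; have [_ ->] := hE _ Dx.
  by have [Ehx vhx] := hE _ Dx; split => //; rewrite vhx.
rewrite fset_set_image; last exact: fD.
rewrite card_in_imfset // => x y; rewrite !in_fset_set; try exact: fD.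
by move=> /set_mem[Dx _] /set_mem[Dy _]; exact: hinj.
Qed.

Lemma gf_setU {T : choiceType} (D E : set T) w :
  finite_fibers D w -> finite_fibers E w ->
  (forall x, D x -> ~ E x) ->
  gf (D `|` E)%classic w = gf D w + gf E w.
Proof.
move=> fD fE DE; apply: fps2P => m r; rewrite coef2D /= -natrD; congr (_%:R).
have -> : fiber (D `|` E)%classic w m r =
          (fiber D w m r `|` fiber E w m r)%classic.
  apply/seteqP; split => x; first by case=> -[Dx|Ex] wx; [left|right]; split.
  by case=> -[Dx wx]; split => //; [left|right].
rewrite fset_setU //; rewrite -cardfsUI -[LHS]addn0; congr addn.
apply/esym/eqP; rewrite cardfs_eq0; apply/eqP/fsetP => x.
rewrite inE !in_fset_set // in_fset0; apply/negP => /andP[].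
by move=> /set_mem[/DE nE _] /set_mem[/nE].
Qed.

Lemma gf_t {T : choiceType} (D : set T) (w : T -> nat * nat) :
  gf D (fun x => ((w x).1.+1, (w x).2)) = fps2_t * gf D w.
Proof.
apply: fps2P => m r; rewrite coef2_tM; case: m => [|m] /=.
  rewrite (_ : fiber _ _ _ _ = set0) ?fset_set0 ?cardfs0 //.
  by apply/seteqP; split => x // -[_].
congr (#|` fset_set _|%fset%:R); apply/seteqP.
by rewrite /fiber; split => x [Dx] /=; case: (w x) => a b [<- <-].
Qed.

Lemma finite_fibers_t {T : Type} (D : set T) (w : T -> nat * nat) :
  finite_fibers D w -> finite_fibers D (fun x => ((w x).1.+1, (w x).2)).
Proof.
move=> fD [|m] r; first by apply: (@sub_finite_set _ _ set0) => // x [_].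
apply: sub_finite_set (fD m r) => x [Dx [wm wr]]; split => //.
by rewrite -wm -wr; apply: surjective_pairing.
Qed.

Lemma cardfsX {T U : choiceType} (A : {fset T}) (B : {fset U}) :
  #|` A `*` B|%fset = (#|` A| * #|` B|)%N.
Proof.
rewrite -(size_allpairs pair); apply/perm_size/uniq_perm => //.
  by apply: allpairs_uniq => // -[a b] [c d].
move=> [x y]; rewrite in_fsetM.
by apply/andP/allpairsP => [[xA yB]|[[a b] [aA bB [-> ->]]]] //; exists (x, y).
Qed.

Lemma fiber_addwP {T U : Type} (D : set T) (E : set U) w v m r x y :
  fiber (D `*` E)%classic (addw w v) m r (x, y) ->
  [/\ fiber D w (w x).1 (w x).2 x,
      fiber E v (m - (w x).1) (r - (w x).2) y,
      ((w x).1 < m.+1)%N & ((w x).2 < r.+1)%N].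
Proof.
move=> [[/= Dx Ey] [<- <-]] /=; rewrite !addKn !ltnS !leq_addr.
by split => //; split => //; apply: surjective_pairing.
Qed.

(** A pair of weight [(m, r)] splits this weight between its components in finitely many ways, so
    its fiber lies in a finite union of products of finite fibers. *)
Lemma finite_fibers_addw {T U : choiceType} (D : set T) (E : set U) w v :
  finite_fibers D w -> finite_fibers E v ->
  finite_fibers (D `*` E)%classic (addw w v).
Proof.
move=> fD fE m r.
apply: (@sub_finite_set _ _ (\bigcup_(i in `I_m.+1) \bigcup_(j in `I_r.+1)
   (fiber D w i j `*` fiber E v (m - i) (r - j)))%classic).
  move=> [x y] xy; have [fx fy im jr] := fiber_addwP xy.
  by exists (w x).1 => //; exists (w x).2.
apply: bigcup_finite => [|i _]; first exact: finite_II.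
apply: bigcup_finite => [|j _]; first exact: finite_II.
exact: finite_setX.
Qed.

Lemma gf_mul {T U : choiceType} (D : set T) (E : set U) w v :
  finite_fibers D w -> finite_fibers E v ->
  gf (D `*` E)%classic (addw w v) = gf D w * gf E v.
Proof.
move=> fD fE; apply: fps2P => m r; rewrite coef2M /=.
have fDE := finite_fibers_addw fD fE m r.
set K := fset_set _.
under eq_bigr do under eq_bigr do rewrite -natrM.
under eq_bigr do rewrite -natr_sum.
rewrite -natr_sum; congr (_%:R).
rewrite pair_big /= -sum1_size.
(* On the fiber the first component has weight at most [(m, r)], so [inord] loses no information
   there. *)
pose p (k : T * U) : 'I_m.+1 * 'I_r.+1 := (inord (w k.1).1, inord (w k.1).2).
rewrite (partition_big p xpredT) //=; apply: eq_bigr => -[i j] _ /=.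
rewrite -cardfsX -fset_setX // -big_filter sum1_size.
apply/perm_size/uniq_perm.
- exact: filter_uniq (fset_uniq _).
- exact: fset_uniq.
move=> [x y]; rewrite mem_filter /p /= !in_fset_set //; last exact: finite_setX.
apply/andP/idP => [[/eqP[ei ej] /set_mem xy]|/set_mem[[/= Dx wx] [Ey vy]]].
  have [fx fy im jr] := fiber_addwP xy.
  by apply/mem_set; split; rewrite /= -ei -ej !inordK.
rewrite wx /= !inord_val; split => //; apply/mem_set; split => //.
by rewrite /addw /= wx vy /= !subnKC // -ltnS.
Qed.

(** * Stable trees *)

Lemma is_stableE s :
  is_stable (Node s) = ((s != [::]) ==> (2 <= size s)%N) && all is_stable s.
Proof.
rewrite /is_stable /= {1}/is_internal /is_leaf /=.
congr ((_ ==> _) && _); first by case: s.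
by elim: s => //= x s IH; rewrite all_cat IH.
Qed.

Lemma nleaves_cons x s :
  nleaves (Node (x :: s)) = (nleaves x + \sum_(y <- s) nleaves y)%N.
Proof.
rewrite /nleaves /= count_cat /is_leaf /= add0n; congr addn.
by elim: s => [|y s IH]; rewrite ?big_nil ?big_cons //= count_cat IH.
Qed.

Lemma ninternal_cons x s :
  ninternal (Node (x :: s)) = (ninternal x + \sum_(y <- s) ninternal y).+1.
Proof.
rewrite /ninternal /= count_cat /is_internal /is_leaf /= add1n.
congr (_ + _).+1.
by elim: s => [|y s IH]; rewrite ?big_nil ?big_cons //= count_cat IH.
Qed.

Lemma ninternal_lt T : is_stable T -> (ninternal T < nleaves T)%N.
Proof. exact: stable_size (leqnn _). Qed.

(* On stable trees the truncated subtraction is exact, by [ninternal_lt]. *)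
Definition weight (T : rrt) : nat * nat :=
  ((nleaves T - (ninternal T).+1)%N, nleaves T).

Definition stable : set rrt := [set T | is_stable T]%classic.
Definition stable_node : set rrt :=
  [set T | is_stable T /\ is_internal T]%classic.

Lemma fiber_stable m r : fiber stable weight m r = stable_rrts m r.
Proof.
apply/seteqP; split => T.
  case=> sT [wm wr]; split => //.
  by rewrite /rrt_dim -wm; have := ninternal_lt sT; lia.
case=> sT <- dT; split => //; congr pair.
by move: dT; rewrite /rrt_dim; have := ninternal_lt sT; lia.
Qed.

Lemma finite_fibers_stable : finite_fibers stable weight.
Proof. by move=> m r; rewrite fiber_stable; apply: finite_stable_rrts. Qed.

Lemma finite_fibers_stable_node : finite_fibers stable_node weight.
Proof. by apply: finite_fibers_sub finite_fibers_stable => T []. Qed.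

Lemma rrt_gfE : rrt_gf = gf stable weight.
Proof.
apply: fps2P => m [|r] /=; last by rewrite fiber_stable.
(* For [r = 0] the value 0 is built into [rrt_gf]; it is the right count because a stable tree has
   more leaves than internal vertices. *)
rewrite (_ : fiber _ _ _ _ = set0) ?fset_set0 ?cardfs0 //.
by apply/seteqP; split => T // -[/ninternal_lt lt [_ T0]]; rewrite T0 in lt.
Qed.

Lemma gf_leaf : gf [set Node [::]]%classic weight = fps2_x.
Proof.
apply: fps2P => m r /=; have [|mr] := boolP (_ && _).
  case/andP=> /eqP-> /eqP->.
  rewrite (_ : fiber _ _ _ _ = [set Node [::]]%classic).
    by rewrite fset_set1 cardfs1.
  by apply/seteqP; split => T; [case|move=> ->; split].
rewrite (_ : fiber _ _ _ _ = set0) ?fset_set0 ?cardfs0 //.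
by apply/seteqP; split => T // -[-> [m0 r1]]; rewrite -m0 -r1 in mr.
Qed.

Lemma rrt_gf_decomp : rrt_gf = gf stable_node weight + fps2_x.
Proof.
rewrite rrt_gfE -gf_leaf -gf_setU; first last.
- by move=> T [_ iT] T0; rewrite T0 in iT.
- by apply: finite_fibers_sub finite_fibers_stable => _ ->.
- exact: finite_fibers_stable_node.
congr gf; apply/seteqP; split => T; last by case=> [[]|->].
by case: T => -[|x s] sT; [right|left].
Qed.

(** * Decomposition by the number of children of the root *)

Definition stable_binary : set rrt :=
  [set T | is_stable T /\ size (children T) = 2%N]%classic.
Definition stable_wide : set rrt :=
  [set T | is_stable T /\ (2 < size (children T))%N]%classic.

(** Grafting two trees onto a new root adds the leaves, and adds the internal vertices plus one; the
    extra vertex absorbs one of the two terms -1, so dimensions add. *)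
Lemma gf_stable_binary : gf stable_binary weight = rrt_gf ^+ 2.
Proof.
have fs := finite_fibers_stable.
rewrite rrt_gfE expr2 -gf_mul //.
apply: (@gf_image _ _ (fun p : rrt * rrt => Node [:: p.1; p.2])).
- exact: finite_fibers_addw.
- move=> [x y] [/= sx sy]; rewrite /stable_binary /stable in sx sy *.
  split; first by split => //; rewrite /= is_stableE /= sx sy.
  rewrite /weight nleaves_cons ninternal_cons !big_seq1 /addw /=.
  by congr pair; have := ninternal_lt sx; have := ninternal_lt sy; lia.
- by move=> [x y] [z t] _ _ /= [-> ->].
- move=> [[|x [|y [|z s]]]] [] //= sT _; exists (x, y) => //.
  by have := sT; rewrite is_stableE /= andbT => /andP[].
Qed.

(** Inserting a tree as new first child of an existing internal root creates no vertex: leaves and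
    internal vertices both add, so the dimension is one more than the sum, whence the factor
    [fps2_t]. *)
Lemma gf_stable_wide :
  gf stable_wide weight = fps2_t * (rrt_gf * gf stable_node weight).
Proof.
have fs := finite_fibers_stable; have fn := finite_fibers_stable_node.
rewrite rrt_gfE -gf_mul // -gf_t.
apply: (@gf_image _ _ (fun p : rrt * rrt => Node (p.1 :: children p.2))).
- exact/finite_fibers_t/finite_fibers_addw.
- move=> [x [[|y s]]] [/= sx [sT]] // _; rewrite /stable /= in sx.
  have := sT; rewrite is_stableE /= => /and3P[s2 sy ss].
  split; first by split => //; rewrite is_stableE /= sx sy ss.
  have := ninternal_lt sx; have := ninternal_lt sT.
  rewrite /weight /addw /= !nleaves_cons !ninternal_cons !big_cons.
  by move=> ? ?; congr pair; lia.
- by move=> [x [s]] [z [t]] _ _ /= [-> ->].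
- move=> [[|x s]] [] //=; rewrite is_stableE /= => /and3P[_ sx ss] s2.
  (* With more than two children at the root, at least two remain after [x], so the rest is stable
     and not a leaf. *)
  exists (x, Node s) => //; split => //=; split.
    by rewrite is_stableE ss andbT; apply/implyP.
  by case: s s2 {ss}.
Qed.

Lemma gf_stable_node :
  gf stable_node weight =
  rrt_gf ^+ 2 + fps2_t * (rrt_gf * gf stable_node weight).
Proof.
rewrite -gf_stable_binary -gf_stable_wide -gf_setU; first last.
- by move=> T [_ s2] [_]; rewrite s2.
- by apply: finite_fibers_sub finite_fibers_stable => T [].
- by apply: finite_fibers_sub finite_fibers_stable => T [].
congr gf; apply/seteqP; split => -[[|x [|y [|z s]]]] //.
- by case.
- by case; rewrite is_stableE.
- by case=> ? _; left.
- by case=> ? _; right.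
all: by case=> -[].
Qed.

(** * The functional equation *)

Lemma rrt_gf_eq : rrt_gf = rrt_gf ^+ 2 / (1 - fps2_t * rrt_gf) + fps2_x.
Proof.
rewrite {1}rrt_gf_decomp; congr (_ + _); apply/esym.
apply: (canLR (mulrK (unit_1_sub_tM rrt_gf))).
rewrite {1}[RHS]mulrBr mulr1 {1}gf_stable_node; ring.
Qed.

(** * Quadratic form of the equation and uniqueness *)

Lemma fps2_eq_quadratic (g : fps2) :
  g = g ^+ 2 / (1 - fps2_t * g) + fps2_x ->
  g = fps2_x + (1 + fps2_t) * g ^+ 2 - fps2_t * fps2_x * g.
Proof.
move=> ge; have u := unit_1_sub_tM g.
have : (g - fps2_x) * (1 - fps2_t * g) = g ^+ 2.
  by rewrite {1}ge addrK divrK.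
(* Only the copy of [g ^+ 2] without the factor [fps2_t] is replaced; the other one cancels. *)
move=> e; rewrite mulrDl mul1r -{1}e; ring.
Qed.

Lemma coef2M00 (f g : fps2) : coef2 (f * g) 0 0 = coef2 f 0 0 * coef2 g 0 0.
Proof. by rewrite coef2M !big_ord_recl !big_ord0 /= !addr0. Qed.

Lemma coef2M01 (f g : fps2) :
  coef2 (f * g) 0 1 = coef2 f 0 0 * coef2 g 0 1 + coef2 f 0 1 * coef2 g 0 0.
Proof. by rewrite coef2M !big_ord_recl !big_ord0 /= !addr0. Qed.

(** All terms with a factor t vanish at order (0, 1). The relation serves twice: a zero constant
    term forces derivative 1, and derivative 1 forces a zero constant term. *)
Lemma coef2_01_quadratic (g : fps2) :
  g = fps2_x + (1 + fps2_t) * g ^+ 2 - fps2_t * fps2_x * g ->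
  coef2 g 0 1 = 1 + 2 * coef2 g 0 0 * coef2 g 0 1.
Proof.
move=> ge; rewrite {1}ge !(coef2D, coef2N, mulrDl, mul1r, expr2) coef2M01.
rewrite -mulrA !coef2_tM /=; ring.
Qed.

(** By induction on the total degree: the coefficient of [h * u] at [(m, r)] is that of [h] plus
    terms containing coefficients of [h] of smaller total degree. *)
Lemma fps2_mul_eq0_coef00 (h u : fps2) : coef2 u 0 0 = 1 -> h * u = 0 -> h = 0.
Proof.
move=> u1 hu; apply: fps2P.
suff H n m r : (m + r <= n)%N -> coef2 h m r = 0 by move=> m r; apply: H.
elim/ltn_ind: n m r => n IH m r mrn.
have := congr1 (fun f => coef2 f m r) hu; rewrite coef2M.
rewrite big_ord_recr /= big_ord_recr /= !subnn u1 mulr1.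
rewrite big1 ?add0r => [|i _].
  rewrite big1 ?add0r // => j _.
  by rewrite (IH (m + j)%N) ?mul0r //; have := ltn_ord j; lia.
rewrite big1 // => j _.
by rewrite (IH (i + j)%N) ?mul0r //; have := ltn_ord i; have := ltn_ord j; lia.
Qed.

Theorem theorem2p1 :
  [/\ rrt_gf = rrt_gf ^+ 2 / (1 - fps2_t * rrt_gf) + fps2_x,
      fps2_at00 (fps2_dx rrt_gf) = 1
    & forall g : fps2,
        g = g ^+ 2 / (1 - fps2_t * g) + fps2_x ->
        fps2_at00 (fps2_dx g) = 1 ->
        g = rrt_gf].
Proof.
have fq := fps2_eq_quadratic rrt_gf_eq.
have f0 : coef2 rrt_gf 0 0 = 0 by [].
split; first exact: rrt_gf_eq.
  rewrite -[LHS]/(coef2 rrt_gf 0 1).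
  by rewrite (coef2_01_quadratic fq) f0 mulr0 mul0r addr0.
move=> g /fps2_eq_quadratic gq; rewrite /fps2_at00 /= mulr1n => g1.
have g0 : coef2 g 0 0 = 0.
  have := coef2_01_quadratic gq; rewrite g1 mulr1 => /eqP.
  by rewrite eq_sym -subr_eq0 addrAC subrr add0r mulf_eq0 /= => /eqP.
apply/eqP; rewrite -subr_eq0; apply/eqP.
(* This factor is the cofactor of [g - rrt_gf] in the difference of the two quadratic equations; its
   constant term is 1 because both series vanish at the origin. *)
apply: (@fps2_mul_eq0_coef00 _
  (1 - (1 + fps2_t) * (g + rrt_gf) + fps2_t * fps2_x)).
  by rewrite !(coef2D, coef2N, coef2M00) f0 g0 /=; ring.
have -> : (g - rrt_gf) *
    (1 - (1 + fps2_t) * (g + rrt_gf) + fps2_t * fps2_x) =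
  (g - (fps2_x + (1 + fps2_t) * g ^+ 2 - fps2_t * fps2_x * g)) -
  (rrt_gf - (fps2_x + (1 + fps2_t) * rrt_gf ^+ 2 - fps2_t * fps2_x * rrt_gf)).
  ring.
by rewrite -gq -fq !subrr.
Qed.
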